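(* Let $P$ be an affine polynomial in the $n$ variables $\theta_i$, $i=1,\ldots,n$, with $P(\mathbf 0)=1$, and let $\Lambda=(\lambda,\lambda_1,\ldots,\lambda_n)$ with $\lambda_i>\lambda>0$ for $i\in\{1,\ldots,n\}$. Suppose that the multivariate multi-factor gamma distribution $\gamma_{(P,\Lambda)}$ associated with $(P,\Lambda)$ exists as a probability distribution on $(0,\infty)^n$ (so that $p_i>0$ for all $i$). Then the Laplace copula of $\gamma_{(P,\Lambda)}$ is $$C_{L_{\gamma_{(P,\Lambda)}}}(\mathbf v)=\Big(\prod_{i=1}^n v_i\Big)\Big[1+\sum_{T\subset[n],\,|T|>1}(-1)^{|T|}P\big(-\tfrac{1}{\mathbf p}\mathbf 1_T\big)\prod_{t\in T}\big(1-v_t^{1/\lambda_t}\big)\Big]^{-\lambda},\qquad \mathbf v=(v_1,\ldots,v_n)\in(0,1]^n,$$ where $|T|$ is the cardinality of $T$ and the vector $\frac1{\mathbf p}\mathbf 1_T\in\mathbb{R}^n$ is defined by $\big(\frac1{\mathbf p}\mathbf 1_T\big)_i=\frac1{p_i}$ if $i\in T$ and $\big(\frac1{\mathbf p}\mathbf 1_T\big)_i=0$ if $i\notin T$.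
   Context: Write $[n]=\{1,\ldots,n\}$. A polynomial $P$ in $\boldsymbol\theta=(\theta_1,\ldots,\theta_n)$ is affine if $\partial^2P/\partial\theta_j^2=0$ for $j=1,\ldots,n$; thus $P(\boldsymbol\theta)=\sum_{T\subset[n]}p_T\prod_{t\in T}\theta_t$, with $p_\varnothing=P(\mathbf 0)=1$ here, and $p_i:=p_{\{i\}}$. The multi-factor gamma distribution $\gamma_{(P,\Lambda)}$ associated with $(P,\Lambda)$ is the distribution of a random vector $\mathbf X$ whose Laplace transform satisfies $$\mathbb{E}\{\exp[-(\theta_1X_1+\cdots+\theta_nX_n)]\}=[P(\boldsymbol\theta)]^{-\lambda}\prod_{i=1}^n(1+p_i\theta_i)^{-(\lambda_i-\lambda)}$$ for a set of $\boldsymbol\theta$ with non-empty interior. Its marginals are gamma distributions with Laplace transform $(1+p_i\theta_i)^{-\lambda_i}$. Laplace copula: for a random vector $\mathbf X$ in $(0,\infty)^n$ with Laplace transform $\varphi_{\mathbf X}(\boldsymbol\theta)=\mathbb{E}\{\exp[-(\theta_1X_1+\cdots+\theta_nX_n)]\}$ and marginal Laplace transforms $\varphi_{X_i}(\theta_i)=\mathbb{E}[\exp(-\theta_iX_i)]$ (each a decreasing bijection from $[0,\infty)$ onto $(0,1]$, with inverse $\varphi_{X_i}^{-1}$), the Laplace copula associated to $\mathbf X$ (or to its distribution) is $C_{L_{\mathbf X}}(u_1,\ldots,u_n)=\varphi_{\mathbf X}\big(\varphi_{X_1}^{-1}(u_1),\ldots,\varphi_{X_n}^{-1}(u_n)\big)$.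 *)

(* Defs.v *)
From HB Require Import structures.
From mathcomp Require Import all_boot all_order all_algebra.
From mathcomp Require Import all_classical all_reals all_analysis.
(* not imported: its notations clash with those of MathComp-Analysis *)
From mathcomp Require mpoly.
Set Implicit Arguments.
Unset Strict Implicit.
Unset Printing Implicit Defensive.
Import Order.TTheory GRing.Theory Num.Theory.
Import numFieldTopology.Exports numFieldNormedType.Exports.
Local Open Scope classical_set_scope.
Local Open Scope ring_scope.

Definition affine_mpoly (R : realType) (n : nat) (P : mpoly.mpoly n R) : Prop :=
  forall j : 'I_n, mpoly.mderiv j (mpoly.mderiv j P) = 0.

Definition lin_coef (R : realType) (n : nat) (P : mpoly.mpoly n R) (i : 'I_n)
  : R := mpoly.mcoeff (mpoly.mnm1 i) P.

(* Extended-real valued: the expectation may be infinite when [theta] has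
   negative coordinates. *)
Definition laplace (R : realType) (d : measure_display) (T : measurableType d)
    (Pr : probability T R) (n : nat) (X : 'I_n -> {RV Pr >-> R})
    (theta : 'rV[R]_n) : \bar R :=
  'E_Pr[fun w => expR (- \sum_(i < n) theta ord0 i * X i w)]%E.

Definition laplace_marg (R : realType) (d : measure_display)
    (T : measurableType d) (Pr : probability T R) (Y : {RV Pr >-> R}) (t : R)
    : \bar R :=
  'E_Pr[fun w => expR (- (t * Y w))]%E.

(* The inverse is that of the restriction of the marginal transform to
   [0, +oo[; the default value 0 is never reached when all coordinates of [X]
   are almost surely positive and [u] ranges over ]0, 1]^n. There the transform
   is also finite, so [fine] loses no information. *)
Definition laplace_copula (R : realType) (d : measure_display)
    (T : measurableType d) (Pr : probability T R) (n : nat)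
    (X : 'I_n -> {RV Pr >-> R}) (u : 'rV[R]_n) : R :=
  fine (laplace X (\row_(i < n)
    'pinv_(fun=> 0) [set t : R | 0 <= t] (laplace_marg (X i)) (u ord0 i)%:E)).

(* The law of [X] is the multi-factor gamma distribution with parameters
   (P, (lambda, lambda_1, ..., lambda_n)). The positivity conditions express
   that the real powers are defined: [powR] is total and takes junk values at
   negative bases. *)
Definition multifactor_gamma (R : realType) (d : measure_display)
    (T : measurableType d) (Pr : probability T R) (n : nat)
    (P : mpoly.mpoly n R) (lam : R) (lams : 'I_n -> R)
    (X : 'I_n -> {RV Pr >-> R}) : Prop :=
  interior [set theta : 'rV[R]_n |
    [/\ 0 < mpoly.meval (theta ord0) P,
        (forall i : 'I_n, 0 < 1 + lin_coef P i * theta ord0 i)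
      & laplace X theta =
          (mpoly.meval (theta ord0) P `^ (- lam) *
           \prod_(i < n)
             (1 + lin_coef P i * theta ord0 i) `^ (- (lams i - lam)))%:E]
  ] !=set0.

Definition inv_coef_ind (R : realType) (n : nat) (P : mpoly.mpoly n R)
    (A : {set 'I_n}) (i : 'I_n) : R :=
  if i \in A then 1 / lin_coef P i else 0.

(* Main.v *)
(* The Laplace transform L of X is known only near some point. In each variable t
   separately, L is a power series around every interior point of its domain,
   and the right-hand side has the form K (A + B t)^(-lam) (1 + p t)^(-mu), so the
   identity is equivalent to a first-order linear differential equation with
   polynomial coefficients, whose two sides are analytic. Hence the identity
   propagates coordinate by coordinate: first upwards, where L remains finite
   because X > 0, then downwards to the positive orthant and, by dominated
   convergence, to [0, +oo)^n. With x_i = v_i^(1/lam_i), the marginal transform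
   (1 + p_i t)^(-lam_i) takes the value v_i at t = (1/x_i - 1) / p_i, and expanding
   x_1 ... x_n P at this point in the variables 1 - x_i gives the formula. *)
Require Import Defs.
From HB Require Import structures.
From mathcomp Require Import all_boot all_order all_algebra.
From mathcomp Require Import all_classical all_reals all_analysis.
From mathcomp Require Import measurable_realfun ring lra.
From mathcomp Require mpoly.
(* importing all of mpoly would clash with the notations of MathComp-Analysis *)
Import (canonicals) mpoly.
Set Implicit Arguments.
Unset Strict Implicit.
Unset Printing Implicit Defensive.
Import Order.TTheory GRing.Theory Num.Theory.
Import numFieldTopology.Exports numFieldNormedType.Exports.
Local Open Scope classical_set_scope.
Local Open Scope ring_scope.

(** * Power series expansions and their termwise differentiation *)

(** Each of the [n + 1] terms in the factorisation of [x ^+ n.+1 - z ^+ n.+1] by [x - z] is at least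
    [z ^+ n]. This controls the factor [n + 1] produced by differentiation. *)
Lemma natr_exprn_le (R : realFieldType) (x z : R) (n : nat) :
  0 <= z -> z < x -> n.+1%:R * z ^+ n * (x - z) <= x ^+ n.+1.
Proof.
move=> z0 zx; have x0 : 0 <= x by rewrite (le_trans z0) ?ltW.
apply: (@le_trans _ _ (x ^+ n.+1 - z ^+ n.+1)); last first.
  by rewrite lerBlDr lerDl exprn_ge0.
rewrite subrXX mulrC ler_pM2l ?subr_gt0//.
rewrite mulr_natl -[X in _ *+ X]card_ord -sumr_const.
apply: ler_sum => i _; have : (i <= n)%N by rewrite -ltnS.
move=> /subnK {1}<-; rewrite exprD ler_wpM2r ?exprn_ge0//.
by rewrite lerXn2r ?nnegrE// ltW.
Qed.

(** Comparison at a radius [y] between [|z|] and [|x|]: the terms of the derived series at [z] are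
    at most [|c i.+1| * y ^+ i.+1 / (y - |z|)] in absolute value. *)
Lemma is_cvg_pseries_diffs (R : realType) (c : R^nat) (x z : R) :
  cvgn (pseries c x) -> `|z| < `|x| -> cvgn (pseries (pseries_diffs c) z).
Proof.
move=> cx zx; pose y := (`|z| + `|x|) / 2.
have zy : `|z| < y by rewrite /y; lra.
have yx : `|y| < `|x| by rewrite ger0_norm /y; [lra|rewrite divr_ge0// addr_ge0].
have {}cy : cvgn (series (fun i => `|c i.+1| * y ^+ i.+1)).
  have := is_cvg_pseries_inside_norm cx yx.
  rewrite /pseries => cy'.
  rewrite (_ : series _ =
    (fun n => [series `|c i| * y ^+ i]_i n.+1 - `|c 0%N|)).
    apply: is_cvgB; last exact: is_cvg_cst.
    by apply: cvgP; rewrite cvg_shiftS; exact: cy'.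
  apply/funext => n; rewrite /series/= big_nat_recl//= expr0 mulr1.
  by rewrite addrAC subrr add0r.
apply: normed_cvg.
apply: (@series_le_cvg _ _ (fun i => (`|c i.+1| * y ^+ i.+1) * (y - `|z|)^-1)).
- by move=> i; rewrite normr_ge0.
- move=> i; apply: divr_ge0; last by rewrite subr_ge0 ltW.
  by apply: mulr_ge0 => //; apply: exprn_ge0; rewrite (le_trans _ (ltW zy)).
- move=> i; rewrite /pseries_diffs/= ler_pdivlMr ?subr_gt0//.
  rewrite !normrM normrX [`|i.+1%:R|]ger0_norm// -!mulrA mulrCA ler_wpM2l//.
  by rewrite mulrA natr_exprn_le.
- rewrite (_ : series _ =
    (fun n => [series `|c i.+1| * y ^+ i.+1]_i n * (y - `|z|)^-1)).
    by apply: is_cvgM => //; exact: is_cvg_cst.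
  by apply/funext => n; rewrite /series/= mulr_suml.
Qed.

(** Analyticity at [t0] with an explicit radius: continuation along a ray needs expansions that
    converge up to the end of the ray. *)
Definition expansion (R : realType) (f : R -> R) (t0 r : R) (c : R^nat) :=
  forall h, `|h| < r -> pseries c h @ \oo --> f (t0 + h).

Lemma expansion_derive (R : realType) (f : R -> R) (t0 r : R) (c : R^nat) h :
  expansion f t0 r c -> `|h| < r ->
  is_derive (t0 + h) 1 f (limn (pseries (pseries_diffs c) h)).
Proof.
move=> fc hr.
(* Three radii between [|h|] and [r]: the differentiation theorem needs convergence of the series
   and of its first two derived series, and each derivation costs some radius. *)
pose K := (`|h| * 3 + r) / 4; pose K2 := (`|h| * 2 + r * 2) / 4.
pose K3 := (`|h| * 1 + r * 3) / 4.
have r0 : 0 < r by rewrite (le_lt_trans _ hr).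
have h0 : 0 <= `|h| by [].
have K0 : `|K| = K by rewrite ger0_norm // /K; lra.
have K20 : `|K2| = K2 by rewrite ger0_norm // /K2; lra.
have K30 : `|K3| = K3 by rewrite ger0_norm // /K3; lra.
have hK : `|h| < `|K| by rewrite K0 /K; lra.
have KK2 : `|K| < `|K2| by rewrite K0 K20 /K /K2; lra.
have K2K3 : `|K2| < `|K3| by rewrite K20 K30 /K3 /K2; lra.
have K3r : `|K3| < r by rewrite K30 /K3; lra.
have c3 : cvgn (pseries c K3) by apply: cvgP; exact: fc.
have c2 := is_cvg_pseries_diffs c3 K2K3.
have c1 := is_cvg_pseries_diffs c2 KK2.
have D := pseries_snd_diffs (is_cvg_pseries_inside c3 (lt_trans KK2 K2K3))
  (is_cvg_pseries_inside c2 KK2) c1 hK.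
have D' : is_derive (t0 + h) 1 (fun x => limn (pseries c (x - t0)))
    (limn (pseries (pseries_diffs c) h)).
  have -> : (fun x => limn (pseries c (x - t0))) =
    (fun x => limn (pseries c x)) \o (fun x => x - t0) by [].
  have E : (t0 + h) - t0 = h by rewrite addrAC subrr add0r.
  have Dg : is_derive (t0 + h) 1 (fun x : R => x - t0) 1.
    by apply: is_derive_eq; rewrite subr0.
  rewrite -[limn _]mulr1; apply: is_derive1_comp; by rewrite E.
apply: near_eq_is_derive D'.
near=> x.
have xr : `|x - t0| < r.
  near: x; apply: (@cvgr_lt _ _ _ _ (fun x => `|x - t0|) `|h|) => //.
  have {1}-> : `|h| = `|t0 + h - t0| by congr (`| _ |); ring.
  by apply: cvg_norm; apply: cvgB; [exact: cvg_id|exact: cvg_cst].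
have := fc _ xr; rewrite [t0 + _]addrC subrK => /cvg_lim -> //.
Unshelve. all: by end_near. Qed.

Lemma expansion_derive1 (R : realType) (f : R -> R) (t0 r : R) (c : R^nat) :
  expansion f t0 r c -> expansion (f^`())%classic t0 r (pseries_diffs c).
Proof.
move=> fc h hr; have D := expansion_derive fc hr.
rewrite derive1E derive_val.
pose x := (`|h| + r) / 2.
have r0 : 0 < r by rewrite (le_lt_trans _ hr).
have h0 : 0 <= `|h| by [].
have x0 : `|x| = x by rewrite ger0_norm // /x; lra.
apply: (@is_cvg_pseries_diffs _ _ x); last by rewrite x0 /x; lra.
by apply: cvgP; apply: fc; rewrite x0 /x; lra.
Qed.

Lemma expansionD (R : realType) (f g : R -> R) (t0 r : R) (b c : R^nat) :
  expansion f t0 r b -> expansion g t0 r c ->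
  expansion (fun t => f t + g t) t0 r (fun k => b k + c k).
Proof.
move=> fb gc h hr; rewrite (_ : pseries _ _ =
  (fun n => pseries b h n + pseries c h n)).
  by apply: cvgD; [exact: fb|exact: gc].
apply/funext => n; rewrite /pseries /series/= -big_split/=.
by apply: eq_bigr => i _; rewrite mulrDl.
Qed.

(** At [t = t0 + h] the factor is [(a + b * t0) + b * h], and multiplying by [h] shifts the
    coefficients by one, hence the 0 at index 0. *)
Lemma expansion_affineM (R : realType) (f : R -> R) (t0 r : R) (c : R^nat)
    (a b : R) :
  expansion f t0 r c ->
  expansion (fun t => (a + b * t) * f t) t0 r
    (fun k => (a + b * t0) * c k + b * (if k is j.+1 then c j else 0)).
Proof.
move=> fc h hr; rewrite -cvg_shiftS (_ : (fun n => _) = (fun n =>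
  (a + b * t0) * pseries c h n.+1 + b * h * pseries c h n)).
  rewrite (_ : _ * f _ = (a + b * t0) * f (t0 + h) + b * h * f (t0 + h)).
    apply: cvgD; last by apply: cvgMr; exact: fc.
    by apply: cvgMr; rewrite (cvg_shiftS (pseries c h)); exact: fc.
  by ring.
apply/funext => n; rewrite /pseries /series/=.
under eq_bigr do rewrite mulrDl -!mulrA.
rewrite big_split/= -mulr_sumr -mulr_sumr; congr (_ + _).
rewrite big_nat_recl//= mul0r add0r -mulrA; congr (_ * _).
by rewrite mulr_sumr; apply: eq_bigr => i _; rewrite exprS; ring.
Qed.

(** * Identity theorem and unique continuation along a ray *)

(** Induction on [k]: the constant coefficient is [f t0], and the derivative of [f] also vanishes
    near [t0], with coefficients [k.+1%:R * c k.+1]. *)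
Lemma expansion_coef_eq0 (R : realType) (f : R -> R) (t0 r e : R) (c : R^nat) :
  0 < r -> 0 < e -> expansion f t0 r c ->
  (forall t, `|t - t0| < e -> f t = 0) -> forall k, c k = 0.
Proof.
move=> r0 e0 fc f0 k; elim: k f c fc f0 => [|k IH] f c fc f0.
  have := fc 0; rewrite normr0 addr0 f0 ?subrr ?normr0// => /(_ r0).
  rewrite -cvg_shiftS (_ : (fun n => _) = (fun=> c 0%N)).
    by move/(cvg_lim (@Rhausdorff R)); rewrite lim_cst.
  apply/funext => n; rewrite /pseries /series/= big_nat_recl//= expr0 mulr1.
  by rewrite big1 ?addr0// => i _; rewrite expr0n/= mulr0.
have /IH : expansion (f^`())%classic t0 r (pseries_diffs c).
  exact: expansion_derive1.
move=> /(_ _)/wrap[t te|].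
  have : is_derive t 1 f 0.
    apply: (@near_eq_is_derive _ _ _ (cst 0)) => //.
    near=> x; rewrite f0//; near: x.
    apply: (@cvgr_lt _ _ _ _ (fun x => `|x - t0|) `|t - t0|) => //.
    by apply: cvg_norm; apply: cvgB; [exact: cvg_id|exact: cvg_cst].
  by move=> /@derive_val; rewrite derive1E.
by move/eqP; rewrite /pseries_diffs mulf_eq0 pnatr_eq0/= => /eqP.
Unshelve. all: by end_near. Qed.

(* A function with an expansion of radius [t0 - a] at every [t0 > a] that
   vanishes on [`]a, t[] vanishes on [`]a, 2 t - a[], by expanding it just
   before [t]. *)
Lemma expansion_unique_continuation (R : realType) (f : R -> R) (a x y : R) :
  a <= x -> x < y ->
  (forall t0, a < t0 -> exists c, expansion f t0 (t0 - a) c) ->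
  (forall t, x < t < y -> f t = 0) -> forall t, a < t -> f t = 0.
Proof.
move=> ax xy fc f0.
have step t0 e : a < t0 -> 0 < e -> (forall t, `|t - t0| < e -> f t = 0) ->
    forall t, `|t - t0| < t0 - a -> f t = 0.
  move=> at0 e0 ft0 t tt0; have [c Hc] := fc _ at0.
  have c0 := expansion_coef_eq0 (_ : 0 < t0 - a) e0 Hc ft0.
  have := Hc _ tt0; rewrite [t0 + _]addrC subrK (_ : pseries _ _ = cst 0).
    by move/(cvg_lim (@Rhausdorff R)); rewrite lim_cst.
  apply/funext => n; rewrite /pseries /series/= big1// => i _.
  by rewrite c0 ?subr_gt0// mul0r.
(* At the start, the disc around the midpoint of []x, y[] reaches down to [a]. Then, if [f] vanishes
   on []a, a + z[], the expansion at [a + 3/4 z] has radius [3/4 z], so [f] vanishes up to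
   [a + 3/2 z]. *)
have H n t : a < t < a + (3 / 2) ^+ n * (y - a) -> f t = 0.
  elim: n t => [|n IH] t.
    rewrite expr0 mul1r addrC subrK => /andP[at_ ty].
    have [xt|tx] := ltP x t; first by apply: f0; rewrite xt.
    apply: (@step ((x + y) / 2) ((y - x) / 2)); [lra|lra| |].
      by move=> u; rewrite ltr_norml => /andP[? ?]; apply: f0; lra.
    by rewrite ltr_norml; apply/andP; split; lra.
  set z := (3 / 2) ^+ n * (y - a) in IH *.
  have -> : (3 / 2) ^+ n.+1 * (y - a) = (3 / 2) * z by rewrite exprS mulrA.
  have z0 : 0 < z by rewrite mulr_gt0 ?exprn_gt0 ?divr_gt0//; lra.
  move=> /andP[at_ tz].
  apply: (@step (a + (3 / 4) * z) (z / 4)); [lra|lra| |].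
    by move=> u; rewrite ltr_norml => /andP[? ?]; apply: IH; lra.
  by rewrite ltr_norml; apply/andP; split; lra.
move=> t at_.
have ya : 0 < y - a by lra.
(* Bernoulli's inequality: the lengths of these intervals are unbounded. *)
have pow n : 1 + n%:R / 2 <= (3 / 2 : R) ^+ n.
  elim: n => [|n IH]; first by rewrite expr0; lra.
  rewrite exprS -natr1; have : 0 <= n%:R :> R by [].
  by move=> ?; nra.
have [n nt] : exists n : nat, (t - a) / (y - a) * 2 < n%:R.
  exists (Num.truncn ((t - a) / (y - a) * 2)).+1.
  by rewrite truncnS_gt.
apply: (H n); rewrite at_/= -ltrBlDl -ltr_pdivrMr//.
by apply: lt_le_trans (pow n); lra.
Qed.

(** * Continuation of an identity with two real powers of affine functions *)

Lemma affine_gt0_noroot (R : realFieldType) (A B a t1 : R) :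
  a < t1 -> 0 < A + B * t1 -> (forall s, a < s -> A + B * s != 0) ->
  forall t, a < t -> 0 < A + B * t.
Proof.
move=> at1 p1 nr t at_; rewrite ltNge; apply/negP => n2.
have B0 : B != 0 by apply/eqP => B0; move: p1 n2; rewrite B0; lra.
have E : A + B * (- A / B) = 0 by field.
have : a < - A / B.
  have [B0'|B0'] := ltP 0 B.
    by apply: lt_le_trans at_ _; rewrite ler_pdivlMr// mulrC; lra.
  have {}B0' : B < 0 by rewrite lt_neqAle B0.
  by apply: lt_trans at1 _; rewrite ltr_ndivlMr// mulrC; lra.
by move/nr; rewrite E eqxx.
Qed.

Lemma is_derive0_cst_ray (R : realType) (f : R -> R) (a : R) :
  (forall t, a < t -> is_derive t 1 f 0) ->
  forall s t, a < s -> a < t -> f s = f t.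
Proof.
move=> f0.
suff H s t : a < s -> s < t -> f s = f t.
  move=> s t as_ at_; have [st|ts|->//] := ltgtP s t; first exact: H.
  by apply/esym; exact: H.
move=> as_ st; have [||c _] := @MVT R f (cst 0) s t st.
- by move=> x; rewrite in_itv/= => /andP[sx _]; apply: f0; lra.
- apply: derivable_within_continuous => x; rewrite in_itv/= => /andP[sx _].
  have ax : a < x by lra.
  by have := f0 _ ax => D.
- by rewrite mul0r => /eqP; rewrite subr_eq0 => /eqP.
Qed.

(* The logarithmic derivative turns the product formula for [f] into the linear
   equation [(A + B t)(C + D t) f' + (lam B (C + D t) + mu D (A + B t)) f = 0]
   with polynomial coefficients, to which unique continuation applies; since
   [f > 0], the equation forbids roots of [A + B t] and [C + D t]. *)
Lemma two_factor_continuation (R : realType) (f : R -> R)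
    (lam mu A B C D K a x y : R) :
  0 < lam -> 0 < mu -> a <= x -> x < y ->
  (forall t, a < t -> 0 < f t) ->
  (forall t0, a < t0 -> exists c, expansion f t0 (t0 - a) c) ->
  (forall t, x < t < y -> [/\ 0 < A + B * t, 0 < C + D * t &
     f t * (A + B * t) `^ lam * (C + D * t) `^ mu = K]) ->
  forall t, a < t -> [/\ 0 < A + B * t, 0 < C + D * t &
     f t * (A + B * t) `^ lam * (C + D * t) `^ mu = K].
Proof.
move=> lam0 mu0 ax xy f0 fc fK.
pose W t := f t * (A + B * t) `^ lam * (C + D * t) `^ mu.
(* The derivative of [W] stripped of its factors with exponents [lam - 1] and [mu - 1]. No real
   power remains, so [G] is analytic on the whole ray whatever the signs of the two bases. *)
pose G t := (A + B * t) * ((C + D * t) * (f^`())%classic t) +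
  ((lam * B * C + mu * D * A) + ((lam + mu) * B * D) * t) * f t.
have df t : a < t -> is_derive t 1 f ((f^`())%classic t).
  move=> at_; have [c Hc] := fc _ at_.
  have := expansion_derive Hc (_ : `|0| < t - a).
  rewrite normr0 addr0 => /(_ _)/wrap[|d]; first by lra.
  by rewrite derive1E; apply: DeriveDef => //; exact: ex_derive.
have fc' t0 : a < t0 -> exists c, expansion (f^`())%classic t0 (t0 - a) c.
  by move=> /fc[c Hc]; eexists; exact: expansion_derive1 Hc.
have daff (u v t : R) : is_derive t 1 (fun t => u + v * t) v.
  by apply: is_derive_eq; rewrite add0r mul1r /GRing.scale/= mulr1.
have dW t : a < t -> 0 < A + B * t -> 0 < C + D * t ->
    is_derive t 1 W ((A + B * t) `^ (lam - 1) * (C + D * t) `^ (mu - 1) * G t).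
  move=> at_ ABt CDt.
  have d1 : is_derive t 1 (fun t => (A + B * t) `^ lam)
      (lam * (A + B * t) `^ (lam - 1) * B).
    exact: (@is_derive1_comp _ (fun u => u `^ lam) (fun t => A + B * t) t _ _
      (is_derive1_powR lam ABt) (daff A B t)).
  have d2 : is_derive t 1 (fun t => (C + D * t) `^ mu)
      (mu * (C + D * t) `^ (mu - 1) * D).
    exact: (@is_derive1_comp _ (fun u => u `^ mu) (fun t => C + D * t) t _ _
      (is_derive1_powR mu CDt) (daff C D t)).
  have d0 := df _ at_.
  apply: is_derive_eq; rewrite /GRing.scale/= /G.
  have powRB1 u v : 0 < u -> u `^ v = u * u `^ (v - 1) :> R.
    move=> u0; have E : 1 + (v - 1) = v by rewrite addrC subrK.
    by rewrite -{2}(powRr1 (ltW u0)) -powRD E// (gt_eqF u0) implybT.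
  rewrite (powRB1 _ lam ABt) (powRB1 _ mu CDt).
  by ring.
have Gc t0 : a < t0 -> exists c, expansion G t0 (t0 - a) c.
  move=> at0; have [c Hc] := fc _ at0; have [c' Hc'] := fc' _ at0.
  eexists; apply: expansionD; last exact: expansion_affineM Hc.
  by apply: expansion_affineM; apply: expansion_affineM; exact: Hc'.
have G0 : forall t, a < t -> G t = 0.
  apply: (expansion_unique_continuation ax xy Gc) => t xty.
  have [ABt CDt _] := fK _ xty.
  have at_ : a < t by case/andP: xty; lra.
  have d0 : is_derive t 1 W 0.
    apply: (@near_eq_is_derive _ _ _ (cst K)) => //.
    near=> s; apply/esym; have [|//] := fK s; near: s.
    by apply: (@near_in_itvoo R x y); rewrite in_itv.
  have /eqP : 'D_1 W t = 0 by rewrite derive_val.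
  have ? := dW _ at_ ABt CDt; rewrite derive_val.
  rewrite !mulf_eq0 (gt_eqF (powR_gt0 _ ABt)) (gt_eqF (powR_gt0 _ CDt))/=.
  by move/eqP.
have xmy : x < (x + y) / 2 < y by lra.
have am : a < (x + y) / 2 by lra.
have [ABm CDm Wm] := fK _ xmy.
(* A common root [s] would give [(t - s) f' + (lam + mu) f = 0], hence
   [f s = 0]. *)
have nocommon s : a < s -> A + B * s = 0 -> C + D * s = 0 -> False.
  move=> as_ As Cs.
  have B0 : B != 0.
    by apply/eqP => B0; move: As ABm; rewrite B0; lra.
  have D0 : D != 0.
    by apply/eqP => D0; move: Cs CDm; rewrite D0; lra.
  pose H t := (- s + 1 * t) * (f^`())%classic t +
    ((lam + mu) + 0 * t) * f t.
  have H0 : forall t, a < t -> H t = 0.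
    (* The factorisation of [G] by [t - s] gives [H = 0] only away from [s]; continuation from []s,
       s + 1[] recovers the value at [s]. *)
    apply: (@expansion_unique_continuation _ _ _ s (s + 1)).
    - exact: ltW.
    - lra.
    - move=> t0 at0; have [c Hc] := fc _ at0; have [c' Hc'] := fc' _ at0.
      eexists; apply: expansionD; last exact: expansion_affineM Hc.
      exact: expansion_affineM Hc'.
    - move=> t /andP[st _].
      have := G0 t (lt_trans as_ st).
      have -> : G t = B * D * (t - s) * H t.
        have EA : A = - (B * s) by lra.
        have EC : C = - (D * s) by lra.
        by rewrite /G /H EA EC; ring.
      move/eqP; rewrite !mulf_eq0 (negbTE B0) (negbTE D0) subr_eq0 gt_eqF//=.
      by move/eqP.
  have := H0 _ as_; rewrite /H mul1r addNr !mul0r add0r addr0 => /eqP.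
  by rewrite mulf_eq0 (gt_eqF (f0 _ as_)) gt_eqF// addr_gt0.
(* At a root [s] of the first base, [G s = 0] reduces to [lam * B * f s * (C + D * s) = 0], which
   makes [s] a common root. *)
have nA s : a < s -> A + B * s != 0.
  move=> as_; apply/eqP => As; apply: (nocommon _ as_ As).
  have B0 : B != 0.
    by apply/eqP => B0; move: As ABm; rewrite B0; lra.
  have := G0 _ as_.
  have -> : G s = lam * B * f s * (C + D * s) +
      (A + B * s) * ((C + D * s) * (f^`())%classic s + mu * D * f s).
    by rewrite /G; ring.
  rewrite As mul0r addr0 => /eqP; rewrite !mulf_eq0 (negbTE B0).
  by rewrite (gt_eqF lam0) (gt_eqF (f0 _ as_))/= => /eqP.
have nC s : a < s -> C + D * s != 0.
  move=> as_; apply/eqP => Cs; move: (nA _ as_); apply/negP; rewrite negbK.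
  have D0 : D != 0.
    by apply/eqP => D0; move: Cs CDm; rewrite D0; lra.
  have := G0 _ as_.
  have -> : G s = mu * D * f s * (A + B * s) +
      (C + D * s) * ((A + B * s) * (f^`())%classic s + lam * B * f s).
    by rewrite /G; ring.
  rewrite Cs mul0r addr0 => /eqP; rewrite !mulf_eq0 (negbTE D0).
  by rewrite (gt_eqF mu0) (gt_eqF (f0 _ as_)).
have pA := affine_gt0_noroot am ABm nA.
have pC := affine_gt0_noroot am CDm nC.
move=> t at_; split; [exact: pA|exact: pC|].
rewrite -Wm; apply: (@is_derive0_cst_ray _ W a) => // s as_.
have := dW s as_ (pA _ as_) (pC _ as_).
by rewrite G0// mulr0.
Unshelve. all: by end_near. Qed.

(** * Power series expansion of Laplace integrals *)

Lemma cvg_series_exp_coeff (R : realType) (x : R) :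
  series (exp_coeff x) @ \oo --> expR x.
Proof. exact: is_cvg_series_exp_coeff. Qed.

(** The partial sums are bounded by [expR |x|], which is one of the two terms on the right; in this
    form the bound is a sum of two Laplace integrands. *)
Lemma norm_series_exp_coeff_le (R : realType) (x : R) (n : nat) :
  `|series (exp_coeff x) n| <= expR x + expR (- x).
Proof.
apply: (@le_trans _ _ (series (exp_coeff `|x|) n)).
  rewrite /series/= (le_trans (ler_norm_sum _ _ _))//.
  apply: ler_sum => i _; rewrite /exp_coeff/= normrM normrX normfV.
  by rewrite [`|_%:R|]ger0_norm.
apply: (@le_trans _ _ (expR `|x|)).
  apply: nondecreasing_cvgn_le; last exact: is_cvg_series_exp_coeff.
  by apply: nondecreasing_series => i _ _; exact: exp_coeff_ge0.
by case: (ger0P x) => _; rewrite ?lerDl ?lerDr expR_ge0.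
Qed.

Lemma norm_exp_coeff_le (R : realType) (x : R) (n : nat) :
  `|exp_coeff x n| <= expR x + expR (- x).
Proof.
apply: (@le_trans _ _ (series (exp_coeff `|x|) n.+1)).
  rewrite seriesEord/= big_ord_recr/= /exp_coeff/= normrM normrX normfV.
  rewrite [`|_%:R|]ger0_norm// lerDr sumr_ge0//.
have := norm_series_exp_coeff_le `|x| n.+1.
rewrite ger0_norm.
  move/le_trans; apply; case: (ger0P x) => _ //.
  by rewrite opprK addrC.
by rewrite /series/=; apply: sumr_ge0 => i _; exact: exp_coeff_ge0.
Qed.

(* Dominated convergence on the partial sums of [exp (- h Y)], bounded by
   [exp (h Y) + exp (- h Y)]. *)
Lemma laplace_expansion (R : realType) (d : measure_display)
    (T : measurableType d) (mu : {measure set T -> \bar R})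
    (w Y : T -> R) (a : R) :
  measurable_fun setT w -> measurable_fun setT Y -> (forall x, 0 <= w x) ->
  (forall t, a < t ->
     mu.-integrable setT (fun x => (w x * expR (- (t * Y x)))%:E)) ->
  forall t0, a < t0 -> exists c,
    expansion (fun t => \int[mu]_x (w x * expR (- (t * Y x)))) t0 (t0 - a) c.
Proof.
move=> mw mY w0 iw t0 at0.
pose W x := w x * expR (- (t0 * Y x)).
have mE t : measurable_fun setT (fun x => expR (- (t * Y x))).
  apply: measurableT_comp => //; apply: measurableT_comp => //.
  by apply: measurable_funM.
have mW : measurable_fun setT W by apply: measurable_funM.
have W0 x : 0 <= W x by rewrite mulr_ge0 ?expR_ge0.
(* Dominating function, integrable because [t0 + h] and [t0 - h] both exceed [a]; this is where the
   radius [t0 - a] comes from. *)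
pose g h x := W x * (expR (- (h * Y x)) + expR (h * Y x)).
have gE h x : g h x = w x * expR (- ((t0 + h) * Y x)) +
                      w x * expR (- ((t0 - h) * Y x)).
  rewrite /g /W mulrDr -!mulrA -!expRD; congr (_ * expR _ + _ * expR _); ring.
have ig h : `|h| < t0 - a -> mu.-integrable setT (fun x => (g h x)%:E).
  rewrite ltr_norml => /andP[h1 h2].
  under eq_fun do rewrite gE EFinD.
  by apply: integrableD => //; apply: iw; lra.
pose u h k x := W x * exp_coeff (- (h * Y x)) k.
have mu_ h k : measurable_fun setT (fun x => (u h k x)%:E).
  apply/measurable_EFinP; apply: measurable_funM => //.
  rewrite /exp_coeff/=; apply: measurable_funM => //.
  apply: measurable_funX => //; apply: measurableT_comp => //.
  by apply: measurable_funM.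
have iu h k : `|h| < t0 - a -> mu.-integrable setT (fun x => (u h k x)%:E).
  move=> hr; apply: (le_integrable _ _ _ (ig _ hr)) => //.
  move=> x _; rewrite !abse_EFin lee_fin /u /g.
  rewrite [leRHS]ger0_norm ?mulr_ge0 ?addr_ge0 ?expR_ge0//.
  rewrite normrM (ger0_norm (W0 x)) ler_wpM2l//.
  by rewrite (le_trans (norm_exp_coeff_le _ _))// opprK.
(* The coefficients are the moments of [- Y] under the weight [W], divided by [k!]. They are
   computed at the auxiliary point [r], where integrability is at hand, and rescaled by [r ^+ k]. *)
pose r := (t0 - a) / 2.
have r0 : 0 < r by rewrite /r; lra.
have rr : `|r| < t0 - a by rewrite gtr0_norm// /r; lra.
have uE h k x : u h k x = u r k x * (h / r) ^+ k.
  rewrite /u -mulrA; congr (_ * _); rewrite /exp_coeff/= mulrAC -exprMn.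
  by congr (_ ^+ _ / _); field; rewrite gt_eqF.
exists (fun k => (\int[mu]_x u r k x) / r ^+ k) => h hr.
have [|||||_ _] := @dominated_convergence _ _ _ mu setT measurableT
  (fun n x => (\sum_(0 <= k < n) (u h k x)%:E)%E)
  (fun x => (w x * expR (- ((t0 + h) * Y x)))%:E) (fun x => (g h x)%:E).
- by move=> n; exact: emeasurable_sum.
- by apply/measurable_EFinP; apply: measurable_funM.
- apply: aeW => x _; under eq_fun do rewrite sumEFin.
  apply: cvg_EFin; first exact: nearW.
  rewrite (_ : fine \o _ =
    (fun n => W x * series (exp_coeff (- (h * Y x))) n)).
    rewrite (_ : w x * _ = W x * expR (- (h * Y x))).
      by apply: cvgMr; exact: cvg_series_exp_coeff.
    by rewrite /W -mulrA -expRD; congr (_ * expR _); ring.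
  by apply/funext => n /=; rewrite /series/= mulr_sumr.
- exact: ig.
- apply: aeW => x n _; rewrite sumEFin abse_EFin lee_fin /u -mulr_sumr.
  rewrite normrM (ger0_norm (W0 x)) /g ler_wpM2l//.
  by rewrite (le_trans (norm_series_exp_coeff_le _ _))// opprK.
rewrite -[X in _ --> X](@fineK _ (\int[mu]_x _)%E); last first.
  apply: integrable_fin_num => //; apply: iw.
  by move: hr; rewrite ltr_norml; lra.
move/fine_cvg; apply: cvg_trans; apply: near_eq_cvg; apply: nearW => n.
rewrite /= integral_sum//; last by move=> k; exact: iu.
rewrite -sum_fine; last first.
  by move=> k _; apply: integrable_fin_num => //; exact: iu.
rewrite /pseries/series/=; apply: eq_bigr => k _.
under eq_integral => x _ do rewrite uE.
rewrite -/(Rintegral _ _ _) RintegralZr//; last exact: iu.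
by rewrite expr_div_n mulrCA mulrC.
Qed.

(** * Affine polynomials as sums over subsets *)

(** With coefficients indexed by subsets, restricting to one variable and expanding products become
    operations on finite sums. *)
Definition multilinear (R : comNzRingType) (n : nat) (c : {set 'I_n} -> R)
  (th : 'I_n -> R) : R := \sum_A c A * \prod_(i in A) th i.

Definition mnm_of_set (n : nat) (A : {set 'I_n}) : mpoly.multinom n :=
  mpoly.Multinom [tuple (i \in A : nat) | i < n].

Lemma mnm_of_set_inj (n : nat) : injective (@mnm_of_set n).
Proof.
move=> A B /mpoly.mnmP AB; apply/setP => i; have := AB i.
by rewrite !mpoly.mnmE; case: (_ \in _) (_ \in _) => -[].
Qed.

(** Lowering the [i]-th exponent of [m] by two gives a monomial whose coefficient in the second
    derivative is a positive integer multiple of that of [m] in [P]. *)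
Lemma affine_mcoeff_eq0 (R : realType) (n : nat) (P : mpoly.mpoly n R)
    (m : mpoly.multinom n) (i : 'I_n) :
  affine_mpoly P -> (1 < mpoly.fun_of_multinom m i)%N -> mpoly.mcoeff m P = 0.
Proof.
move=> /(_ i) /mpoly.mpolyP + mi.
pose u := mpoly.mnm1 i; pose m1 := mpoly.mnm_sub (mpoly.mnm_sub m u) u.
move=> /(_ m1); rewrite !mpoly.mcoeff_deriv mpoly.mcoeff0.
have -> : mpoly.mnm_add (mpoly.mnm_add m1 u) u = m.
  apply/mpoly.mnmP => j.
  rewrite /m1 !(mpoly.mnmDE, mpoly.mnmBE) mpoly.mnm1E.
  case: eqVneq => [<-|_]; last by rewrite !subn0 !addn0.
  by rewrite /= -subnDA -addnA subnK.
by move/eqP; rewrite -mulrnA mulrn_eq0 muln_eq0/= => /eqP.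
Qed.

(** All exponents in the support of [P] are 0 or 1, so its monomials are indicators of subsets. *)
Lemma affine_mevalE (R : realType) (n : nat) (P : mpoly.mpoly n R)
    (th : 'I_n -> R) : affine_mpoly P ->
  mpoly.meval th P = multilinear (fun A => mpoly.mcoeff (mnm_of_set A) P) th.
Proof.
move=> aP; rewrite mpoly.mevalE.
have suppE : perm_eq (mpoly.msupp P) [seq mnm_of_set A | A <- enum {set 'I_n}
    & mpoly.mcoeff (mnm_of_set A) P != 0].
  apply: uniq_perm; first exact: mpoly.msupp_uniq.
    by rewrite (map_inj_uniq (@mnm_of_set_inj n)) filter_uniq ?enum_uniq.
  move=> m; rewrite mpoly.mcoeff_msupp.
  apply/idP/mapP => [Pm|[A + ->]]; last by rewrite mem_filter => /andP[].
  pose A := [set i | mpoly.fun_of_multinom m i == 1%N]%SET.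
  suff Am : m = mnm_of_set A by exists A; rewrite // mem_filter -Am Pm mem_enum.
  apply/mpoly.mnmP => i; rewrite mpoly.mnmE inE.
  have : ~~ (1 < mpoly.fun_of_multinom m i)%N.
    by apply: contra Pm => mi; rewrite (affine_mcoeff_eq0 aP mi).
  by case: (mpoly.fun_of_multinom m i) => [|[|]].
rewrite (perm_big _ suppE)/= big_map big_filter big_enum_cond big_mkcond/=.
apply: eq_bigr => A _; case: eqP => [->|_]; first by rewrite !mul0r.
congr (_ * _); rewrite [RHS]big_mkcond/=; apply: eq_bigr => i _.
by rewrite mpoly.mnmE; case: (_ \in _).
Qed.

Lemma multilinear0 (R : comNzRingType) (n : nat) (c : {set 'I_n} -> R) :
  multilinear c (fun=> 0) = c finset.set0.
Proof.
rewrite /multilinear (bigD1 finset.set0)//= big_set0 mulr1 big1 ?addr0// => A.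
by move=> /set0Pn[i iA]; rewrite (bigD1 i)//= mul0r mulr0.
Qed.

Definition upd (R : Type) (n : nat) (th : 'I_n -> R) (j : 'I_n) (t : R) :=
  fun i => if i == j then t else th i.

Lemma upd_id (R : Type) (n : nat) (th : 'I_n -> R) (j : 'I_n) :
  upd th j (th j) = th.
Proof. by apply/funext => i; rewrite /upd; case: eqP => [->|]. Qed.

(** Subsets without [j] feed only the constant term, the others only the slope. This supplies the
    factor [A + B * t] of the one-variable continuation. *)
Lemma multilinear_upd (R : comNzRingType) (n : nat) (c : {set 'I_n} -> R)
    (th : 'I_n -> R) (j : 'I_n) (t : R) :
  multilinear c (upd th j t) = multilinear c (upd th j 0) +
   (multilinear c (upd th j 1) - multilinear c (upd th j 0)) * t.
Proof.
rewrite /multilinear -sumrB mulr_suml -big_split/=; apply: eq_bigr => A _.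
have [jA|jA] := boolP (j \in A); last first.
  have E s : \prod_(i in A) upd th j s i = \prod_(i in A) th i.
    apply: eq_bigr => i iA; rewrite /upd; case: eqP => // ij.
    by move: jA; rewrite -ij iA.
  by rewrite !E subrr mul0r addr0.
have E s : \prod_(i in A) upd th j s i = s * \prod_(i in A | i != j) th i.
  rewrite (bigD1 j)//= {1}/upd eqxx; congr (_ * _).
  by apply: eq_bigr => i /andP[_ ij]; rewrite /upd (negbTE ij).
by rewrite !E; ring.
Qed.

Lemma multilinear_axis (R : comNzRingType) (n : nat) (c : {set 'I_n} -> R)
    (j : 'I_n) (t : R) :
  multilinear c (upd (fun=> 0) j t) = c finset.set0 + c [set j]%SET * t.
Proof.
rewrite /multilinear (bigD1 finset.set0)//= big_set0 mulr1; congr (_ + _).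
rewrite (bigD1 [set j]%SET)/=; last by rewrite -cards_eq0 cards1.
rewrite big_set1 {1}/upd eqxx big1 ?addr0// => A /andP[A0 Aj].
have /subsetPn[i iA] : ~~ (A \subset [set j]%SET).
  by rewrite subset1 negb_or Aj.
rewrite inE => ij; rewrite (bigD1 i)//= /upd (negbTE ij) mul0r mulr0.
by [].
Qed.

(* Substituting [x i = 1 - y i] and expanding the products makes the
   coefficient of [\prod_(i in A) y i] the value of [P] at [- 1_A / p]. *)
Lemma multilinear_reciprocal (R : fieldType) (n : nat) (c : {set 'I_n} -> R)
    (x : 'I_n -> R) :
  c finset.set0 = 1 -> (forall i, c [set i]%SET != 0) -> (forall i, x i != 0) ->
  (\prod_i x i) * multilinear c (fun i => ((x i)^-1 - 1) / c [set i]%SET) =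
  1 + \sum_(A : {set 'I_n} | (1 < #|A|)%N)
    (-1) ^+ #|A| *
    multilinear c (fun i => - (if i \in A then 1 / c [set i]%SET else 0)) *
    \prod_(t in A) (1 - x t).
Proof.
move=> c0 p0 x0.
pose q (A : {set 'I_n}) i := - (if i \in A then 1 / c [set i]%SET else 0).
pose F (A : {set _}) := (-1) ^+ #|A| * multilinear c (q A) * \prod_(t in A) (1 - x t).
transitivity (\sum_A F A).
  rewrite /F /multilinear mulr_sumr.
  under [RHS]eq_bigr do rewrite mulr_sumr mulr_suml.
  rewrite [RHS]exchange_big/=; apply: eq_bigr => B _.
  rewrite mulrCA.
  (* Each [x i], multiplied by the [i]-th argument if [i] is in [B], is split into two summands;
     expanding the product takes the first summand exactly on [A]. *)
  transitivity (c B * \prod_i ((- (1 - x i) * (if i \in B then - (c [set i]%SET)^-1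
     else 1)) + (if i \in B then 0 else 1))).
    congr (_ * _); rewrite [X in _ * X]big_mkcond/= -big_split/=.
    apply: eq_bigr => i _; case: ifP => _; last by ring.
    by field; rewrite x0 p0.
  rewrite bigA_distr mulr_sumr; apply: eq_big => [A|A _]; first by rewrite inE.
  rewrite -prodr_const [RHS](_ : _ = c B * (\prod_(i in A) (-1) *
    \prod_(i in B) q A i * \prod_(t in A) (1 - x t))); last by ring.
  congr (_ * _); rewrite [\prod_(i in A) -1]big_mkcond.
  rewrite [\prod_(i in B) _]big_mkcond [\prod_(t in A) _]big_mkcond/=.
  rewrite -big_split/= -big_split/=.
  apply: eq_bigr => i _; rewrite /q.
  by case: (i \in A) (i \in B) => -[]; rewrite ?div1r; ring.
(* The empty set contributes the constant 1; the singleton of [j] contributes nothing, since the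
   polynomial takes the value [1 - p_j / p_j = 0] there. *)
rewrite (bigID (fun A : {set 'I_n} => (1 < #|A|)%N))/= addrC; congr (_ + _).
rewrite (bigD1 finset.set0) ?cards0//= big1 => [|A /andP[A1 A0]].
  rewrite /F cards0 expr0 big_set0 mulr1 mul1r addr0.
  rewrite (_ : q _ = fun=> 0) ?multilinear0//.
  by apply/funext => i; rewrite /q inE oppr0.
have /cards1P[j ->] : #|A| == 1%N.
  by rewrite eqn_leq leqNgt A1/= lt0n cards_eq0.
rewrite /F (_ : q _ = upd (fun=> 0) j (- (c [set j]%SET)^-1)).
  by rewrite multilinear_axis mulrN mulfV// c0 subrr mulr0 mul0r.
by apply/funext => i; rewrite /q /upd inE; case: eqP => [->|]; rewrite ?div1r ?oppr0.
Qed.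

(** * Laplace transform of a random vector and its restriction to one variable *)

(** A zero integral would force [f = 0] almost everywhere, and the whole space, of mass 1, would be
    negligible. *)
Lemma Rintegral_gt0 (R : realType) (d : measure_display)
    (T : measurableType d) (Pr : probability T R) (f : T -> R) :
  Pr.-integrable setT (EFin \o f) -> (forall w, 0 <= f w) ->
  {ae Pr, forall w, 0 < f w} -> 0 < \int[Pr]_w f w.
Proof.
move=> intf f0 fae; have mf := measurable_int _ intf.
rewrite lt_neqAle Rintegral_ge0// andbT; apply/negP => /eqP I0.
have : (\int[Pr]_(w in setT) `|(EFin \o f) w|)%E = 0%E.
  under eq_integral do rewrite /= ger0_norm//.
  rewrite -[LHS]fineK; last exact: integrable_fin_num.
  by rewrite -[fine _]/(Rintegral Pr setT f) -I0.
move/(ae_eq_integral_abs Pr measurableT mf) => f0ae.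
have : {ae Pr, forall w : T, False}.
  apply: filterS2 fae f0ae => w fw /(_ I) [fw0].
  by rewrite fw0 ltxx in fw.
move=> [A [mA A0 /= subA]].
have AT : A = setT by apply/seteqP; split => // w _; apply: subA => /=; exact.
by have := probability_setT Pr; rewrite -AT A0 => /eqP; rewrite eq_sym onee_eq0.
Qed.

(** Real-valued, with the default value 0 where the integral diverges; hence the companion predicate
    [Laplace_finite]. *)
Definition Laplace (R : realType) (d : measure_display)
    (T : measurableType d) (Pr : probability T R) (n : nat)
    (X : 'I_n -> {RV Pr >-> R}) (th : 'I_n -> R) : R :=
  \int[Pr]_w expR (- \sum_(i < n) th i * X i w).

Definition Laplace_finite (R : realType) (d : measure_display)
    (T : measurableType d) (Pr : probability T R) (n : nat)
    (X : 'I_n -> {RV Pr >-> R}) (th : 'I_n -> R) : Prop :=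
  Pr.-integrable setT (EFin \o fun w => expR (- \sum_(i < n) th i * X i w)).

Lemma measurable_Laplace_integrand (R : realType) (d : measure_display)
    (T : measurableType d) (Pr : probability T R) (n : nat)
    (X : 'I_n -> {RV Pr >-> R}) (th : 'I_n -> R) (p : pred 'I_n) :
  measurable_fun setT (fun w => expR (- \sum_(i < n | p i) th i * X i w)).
Proof.
apply: measurableT_comp => //; apply: measurableT_comp => //.
under eq_fun do rewrite big_mkcond/=.
apply: measurable_sum => i; case: (p i) => //.
by apply: measurable_funM.
Qed.

Lemma Laplace_gt0 (R : realType) (d : measure_display)
    (T : measurableType d) (Pr : probability T R) (n : nat)
    (X : 'I_n -> {RV Pr >-> R}) (th : 'I_n -> R) :
  Laplace_finite X th -> 0 < Laplace X th.
Proof.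
move=> fX; apply: Rintegral_gt0 => //.
by apply: aeW => w; exact: expR_gt0.
Qed.

(** Positivity of [X] makes the integrand decreasing in every coordinate of [th]. *)
Lemma Laplace_finite_le (R : realType) (d : measure_display)
    (T : measurableType d) (Pr : probability T R) (n : nat)
    (X : 'I_n -> {RV Pr >-> R}) (th th' : 'I_n -> R) :
  {ae Pr, forall w, forall i, 0 < X i w} ->
  (forall i, th i <= th' i) -> Laplace_finite X th -> Laplace_finite X th'.
Proof.
move=> X0 le_th /integrableP[m1 i1]; apply/integrableP; split.
  by apply/measurable_EFinP; exact: measurable_Laplace_integrand.
apply: le_lt_trans i1; apply: ae_ge0_le_integral => //.
- apply: measurableT_comp => //.
  by apply/measurable_EFinP; exact: measurable_Laplace_integrand.
- exact: measurableT_comp.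
- apply: filterS X0 => w Xw _ /=; rewrite lee_fin !ger0_norm ?expR_ge0//.
  rewrite ler_expR lerN2; apply: ler_sum => i _.
  by rewrite ler_pM2r.
Qed.

Lemma sum_upd (R : realType) (n : nat) (th x : 'I_n -> R) (j : 'I_n) (t : R) :
  \sum_i upd th j t i * x i = t * x j + \sum_(i | i != j) th i * x i.
Proof.
rewrite (bigD1 j)//= {1}/upd eqxx; congr (_ + _); apply: eq_bigr => i ij.
by rewrite /upd (negbTE ij).
Qed.

(** The coordinates other than [j] are absorbed into the weight of a one-variable Laplace
    integral. *)
Lemma Laplace_upd_expansion (R : realType) (d : measure_display)
    (T : measurableType d) (Pr : probability T R) (n : nat)
    (X : 'I_n -> {RV Pr >-> R}) (th : 'I_n -> R) (j : 'I_n) (a : R) :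
  (forall t, a < t -> Laplace_finite X (upd th j t)) ->
  forall t0, a < t0 -> exists c,
    expansion (fun t => Laplace X (upd th j t)) t0 (t0 - a) c.
Proof.
move=> fX.
have E t w : expR (- \sum_(i < n) upd th j t i * X i w) =
    expR (- \sum_(i < n | i != j) th i * X i w) * expR (- (t * X j w)).
  by rewrite (sum_upd th (X ^~ w)) opprD expRD mulrC.
rewrite (_ : (fun t => _) = (fun t => \int[Pr]_w
    (expR (- \sum_(i < n | i != j) th i * X i w) * expR (- (t * X j w))))).
  apply: laplace_expansion => //.
  - exact: measurable_Laplace_integrand.
  - by move=> t /fX; rewrite /Laplace_finite; apply: eq_integrable => // w _; rewrite /= E.
apply/funext => t; rewrite /Laplace; apply: eq_Rintegral => w _.
exact: E.
Qed.

(* The defining identity of the multi-factor gamma law, cleared of negative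
   powers. *)
Definition gamma_at (R : realType) (n : nat) (c : {set 'I_n} -> R) (lam : R)
    (lams : 'I_n -> R) (L : ('I_n -> R) -> R) (th : 'I_n -> R) : Prop :=
  [/\ 0 < multilinear c th, (forall i, 0 < 1 + c [set i]%SET * th i) &
      L th * multilinear c th `^ lam *
        \prod_i (1 + c [set i]%SET * th i) `^ (lams i - lam) = 1].

Lemma gamma_at_upd (R : realType) (n : nat) (c : {set 'I_n} -> R) (lam : R)
    (lams : 'I_n -> R) (L : ('I_n -> R) -> R) (th : 'I_n -> R) (j : 'I_n)
    (t : R) (A := multilinear c (upd th j 0))
    (B := multilinear c (upd th j 1) - multilinear c (upd th j 0))
    (K := (\prod_(i | i != j)
             (1 + c [set i]%SET * th i) `^ (lams i - lam))) :
  (forall i, i != j -> 0 < 1 + c [set i]%SET * th i) ->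
  gamma_at c lam lams L (upd th j t) <->
  [/\ 0 < A + B * t, 0 < 1 + c [set j]%SET * t &
      L (upd th j t) * (A + B * t) `^ lam *
        (1 + c [set j]%SET * t) `^ (lams j - lam) = K^-1].
Proof.
move=> p0; rewrite /gamma_at multilinear_upd -/A -/B.
have K0 : 0 < K by apply: prodr_gt0 => i ij; rewrite powR_gt0 ?p0.
rewrite (bigD1 j)//= [upd th j t j]/upd eqxx.
have -> : \prod_(i < n | i != j)
    (1 + c [set i]%SET * upd th j t i) `^ (lams i - lam) = K.
  by apply: eq_bigr => i ij; rewrite /upd (negbTE ij).
have -> : (forall i, 0 < 1 + c [set i]%SET * upd th j t i) =
    (0 < 1 + c [set j]%SET * t).
  apply/propext.
  split => [/(_ j)|pj i]; first by rewrite /upd eqxx.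
  by rewrite /upd; case: eqP => [->//|/eqP]; exact: p0.
split=> -[pA pC E]; split => //.
  apply: (mulIf (lt0r_neq0 K0)); rewrite [RHS]mulVf ?lt0r_neq0// -[RHS]E.
  by rewrite !mulrA.
by rewrite mulrA E mulVf// lt0r_neq0.
Qed.

(** * Propagation of the gamma identity to the non-negative orthant *)

(** Coordinates are released one at a time: at stage [k] the first [k] range over [V] and the others
    still over [U]. *)
Lemma coordinatewise_extension (R : Type) (n : nat) (U V : 'I_n -> R -> Prop)
    (G : ('I_n -> R) -> Prop) :
  (forall i t, U i t -> V i t) ->
  (forall th j, (forall i, V i (th i)) -> (forall t, U j t -> G (upd th j t)) ->
     G th) ->
  (forall th, (forall i, U i (th i)) -> G th) ->
  forall th, (forall i, V i (th i)) -> G th.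
Proof.
move=> UV step G0.
suff H k : (k <= n)%N -> forall th : 'I_n -> R,
    (forall i : 'I_n, (i < k)%N -> V i (th i)) ->
    (forall i : 'I_n, (k <= i)%N -> U i (th i)) -> G th.
  move=> th Vth; apply: (H n (leqnn n)) => i; first by move=> _; exact: Vth.
  by rewrite leqNgt ltn_ord.
elim: k => [|k IH] kn th Vth Uth; first by apply: G0 => i; exact: Uth.
pose j := Ordinal kn.
apply: (step _ j) => [i|t Ujt].
  have [ik|ki] := ltnP i k.+1; first exact: Vth.
  by apply: UV; exact: Uth.
apply: IH => [|i ik|i ki]; first exact: ltnW.
- rewrite /upd; case: eqP => [->|_]; first exact: UV.
  by apply: Vth; rewrite ltnS ltnW.
- rewrite /upd; case: eqVneq => [->//|ij]; apply: Uth.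
  by rewrite ltn_neqAle ki andbT; apply: contra ij => /eqP kE; apply/eqP/val_inj.
Qed.

Lemma gamma_at_continuation (R : realType) (d : measure_display)
    (T : measurableType d) (Pr : probability T R) (n : nat)
    (X : 'I_n -> {RV Pr >-> R}) (c : {set 'I_n} -> R) (lam : R)
    (lams : 'I_n -> R) (th : 'I_n -> R) (j : 'I_n) (a x y : R) :
  0 < lam -> lam < lams j -> a <= x -> x < y ->
  (forall t, a < t -> Laplace_finite X (upd th j t)) ->
  (forall t, x < t < y -> gamma_at c lam lams (Laplace X) (upd th j t)) ->
  forall t, a < t -> gamma_at c lam lams (Laplace X) (upd th j t).
Proof.
move=> lam0 lamj ax xy fX gX.
have p0 i : i != j -> 0 < 1 + c [set i]%SET * th i.
  move=> ij; have /gX[_ /(_ i)] : x < (x + y) / 2 < y by lra.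
  by rewrite /upd (negbTE ij).
move=> t at_; apply/gamma_at_upd => //; move: t at_.
apply: (two_factor_continuation lam0 _ ax xy) => [|t at_||t xty].
- by rewrite subr_gt0.
- by apply: Laplace_gt0; exact: fX.
- exact: Laplace_upd_expansion.
- by apply/gamma_at_upd => //; exact: gX.
Qed.

(** At [l = 0] the power is continuous only from the right, which is enough because [u] is
    positive. *)
Lemma powR_cvg_seq (R : realType) (u : R^nat) (l r : R) : 0 < r ->
  (forall m, 0 < u m) -> u @ \oo --> l -> u m `^ r @[m --> \oo] --> l `^ r.
Proof.
move=> r0 u0 ul.
have l0 : 0 <= l.
  rewrite -(cvg_lim (@Rhausdorff R) ul); apply: limr_ge; first exact: cvgP ul.
  by apply: nearW => m; exact: ltW.
move: l0; rewrite le_eqVlt => /predU1P[l0|l0]; last first.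
  apply: (@continuous_cvg _ _ _ _ _ u (fun x => x `^ r)) => //.
  apply: differentiable_continuous; apply/derivable1_diffP.
  by have := is_derive1_powR r l0 => D; exact: ex_derive.
rewrite -l0 powR0 ?gt_eqF//.
have /cvg_at_rightP := @powR_cvg0 R r r0; apply; split => //.
by rewrite l0.
Qed.

Lemma Laplace_finite_ge0 (R : realType) (d : measure_display)
    (T : measurableType d) (Pr : probability T R) (n : nat)
    (X : 'I_n -> {RV Pr >-> R}) (th : 'I_n -> R) :
  {ae Pr, forall w, forall i, 0 < X i w} ->
  (forall i, 0 <= th i) -> Laplace_finite X th.
Proof.
move=> X0 th0; apply: (Laplace_finite_le X0 th0).
rewrite /Laplace_finite (_ : _ \o _ = EFin \o cst 1).
  exact: finite_measure_integrable_cst.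
by apply/funext => w /=; rewrite big1 ?oppr0 ?expR0// => i _; rewrite mul0r.
Qed.

(** On the non-negative orthant the integrand is almost surely bounded by 1, so dominated
    convergence applies. *)
Lemma Laplace_upd_cvg0 (R : realType) (d : measure_display)
    (T : measurableType d) (Pr : probability T R) (n : nat)
    (X : 'I_n -> {RV Pr >-> R}) (th : 'I_n -> R) (j : 'I_n) (u : R^nat) :
  {ae Pr, forall w, forall i, 0 < X i w} ->
  (forall i, 0 <= th i) -> (forall m, 0 < u m) -> u @ \oo --> 0 ->
  Laplace X (upd th j (u m)) @[m --> \oo] --> Laplace X (upd th j 0).
Proof.
move=> X0 th0 u0 ucvg.
have upd0 t : 0 <= t -> forall i, 0 <= upd th j t i.
  by move=> t0 i; rewrite /upd; case: eqP.
pose F t w := (expR (- \sum_(i < n) upd th j t i * X i w))%:E.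
have mF t : measurable_fun setT (F t).
  by apply/measurable_EFinP; exact: measurable_Laplace_integrand.
have [|||||_ _] := @dominated_convergence _ _ _ Pr setT measurableT
  (fun m => F (u m)) (F 0) (cst 1%E) => //.
- apply: aeW => w _; apply: cvg_EFin; first exact: nearW.
  apply: (@continuous_cvg _ _ _ _ _ _ expR); first exact: continuous_expR.
  apply: cvgN; rewrite (sum_upd th (X ^~ w)).
  under eq_fun do rewrite (sum_upd th (X ^~ w)).
  by apply: cvgD; [apply: cvgMl|exact: cvg_cst].
- exact: finite_measure_integrable_cst.
- apply: filterS X0 => w Xw m _; rewrite /F abse_EFin lee_fin.
  rewrite ger0_norm ?expR_ge0// -expR0 ler_expR lerNl oppr0.
  by apply: sumr_ge0 => i _; rewrite mulr_ge0 ?upd0// ltW.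
have fin : (\int[Pr]_(w in setT) F 0%R w)%E \is a fin_num.
  apply: integrable_fin_num => //; apply: (Laplace_finite_ge0 X0).
  exact: upd0.
by rewrite -(fineK fin) => /fine_cvg.
Qed.

Lemma gamma_at_closure (R : realType) (d : measure_display)
    (T : measurableType d) (Pr : probability T R) (n : nat)
    (X : 'I_n -> {RV Pr >-> R}) (c : {set 'I_n} -> R) (lam : R)
    (lams : 'I_n -> R) (th : 'I_n -> R) (j : 'I_n) :
  0 < lam -> lam < lams j ->
  {ae Pr, forall w, forall i, 0 < X i w} -> (forall i, 0 <= th i) ->
  (forall t, 0 < t -> gamma_at c lam lams (Laplace X) (upd th j t)) ->
  gamma_at c lam lams (Laplace X) (upd th j 0).
Proof.
move=> lam0 lamj X0 th0 gX.
have p0 i : i != j -> 0 < 1 + c [set i]%SET * th i.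
  move=> ij; have [_ /(_ i)] := gX 1 ltr01.
  by rewrite /upd (negbTE ij).
apply/gamma_at_upd => //; rewrite !mulr0 !addr0.
have gX' t (t0 : 0 < t) :=
  (@gamma_at_upd _ _ c lam lams (Laplace X) th j t p0).1 (gX t t0).
set A := multilinear c (upd th j 0) in gX' *.
set B := multilinear c (upd th j 1) - A in gX'.
set K := \prod_(i | i != j) (1 + c [set i]%SET * th i) `^ (lams i - lam)
  in gX' *.
have K0 : 0 < K by apply: prodr_gt0 => i ij; rewrite powR_gt0 ?p0.
have h0 m : 0 < harmonic m :> R by rewrite /harmonic/= invr_gt0.
have affc (a b : R) : a + b * harmonic m @[m --> \oo] --> a.
  rewrite -[X in _ --> X]addr0 -[X in _ --> _ + X](mulr0 b).
  by apply: cvgD; [exact: cvg_cst|apply: cvgMr; exact: cvg_harmonic].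
have gh m := gX' _ (h0 m).
have A0 : 0 <= A.
  rewrite -(cvg_lim (@Rhausdorff R) (affc A B)).
  apply: limr_ge; first exact: cvgP (affc A B).
  by apply: nearW => m; have [/ltW] := gh m.
have E : Laplace X (upd th j 0) * A `^ lam * 1 `^ (lams j - lam) = K^-1.
  apply: (@cvg_unique _ (@Rhausdorff R) (fmap (fun m => Laplace X
    (upd th j (harmonic m)) * (A + B * harmonic m) `^ lam *
    (1 + c [set j]%SET * harmonic m) `^ (lams j - lam)) \oo)); last first.
    rewrite (_ : (fun m => _) = cst K^-1); first exact: cvg_cst.
    by apply/funext => m; have [] := gh m.
  apply: cvgM; last first.
    apply: powR_cvg_seq => //; first by rewrite subr_gt0.
    by move=> m; have [] := gh m.
  apply: cvgM; last first.
    by apply: powR_cvg_seq => // m; have [] := gh m.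
  apply: Laplace_upd_cvg0 => //; exact: cvg_harmonic.
split => //.
(* The limit gives only [0 <= A]; if [A] were 0, the left-hand side of [E] would vanish while [K^-1]
   does not. *)
rewrite lt_neqAle A0 andbT eq_sym; apply/eqP => Az; move: E.
rewrite Az powR0 ?gt_eqF// mulr0 mul0r => /esym/eqP.
by rewrite invr_eq0 gt_eqF.
Qed.

Lemma ae_forall_gt0 (R : realType) (d : measure_display)
    (T : measurableType d) (Pr : probability T R) (n : nat)
    (X : 'I_n -> {RV Pr >-> R}) :
  Pr [set w | forall i : 'I_n, 0 < X i w] = 1%E ->
  {ae Pr, forall w, forall i, 0 < X i w}.
Proof.
move=> X1; set S := [set w | _] in X1.
have mS : measurable S.
  rewrite (_ : S = \bigcap_(i in [set: 'I_n]) (X i @^-1` `]0, +oo[%classic)).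
    apply: fin_bigcap_measurable => // i _.
    rewrite -[X in measurable X]setTI; exact: measurable_funP.
  apply/seteqP; split=> w Sw i; first by move=> _ /=; rewrite in_itv/= Sw.
  by have := Sw i I; rewrite /= in_itv/= andbT.
exists (~` S); split => //; first exact: measurableC.
by rewrite probability_setC// X1 subee.
Qed.

Lemma laplace_rowE (R : realType) (d : measure_display)
    (T : measurableType d) (Pr : probability T R) (n : nat)
    (X : 'I_n -> {RV Pr >-> R}) (th : 'I_n -> R) :
  laplace X (\row_i th i) =
  (\int[Pr]_w (expR (- \sum_(i < n) th i * X i w))%:E)%E.
Proof.
rewrite /laplace unlock; apply: eq_integral => w _.
by congr ((expR (- _))%:E); apply: eq_bigr => i _; rewrite mxE.
Qed.

Lemma laplace_margE (R : realType) (d : measure_display)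
    (T : measurableType d) (Pr : probability T R) (n : nat)
    (X : 'I_n -> {RV Pr >-> R}) (j : 'I_n) (t : R) :
  {ae Pr, forall w, forall i, 0 < X i w} -> 0 <= t ->
  laplace_marg (X j) t = (Laplace X (upd (fun=> 0) j t))%:E.
Proof.
move=> X0 t0; rewrite /Laplace /Rintegral fineK; last first.
  apply: integrable_fin_num => //; apply: (Laplace_finite_ge0 X0) => i.
  by rewrite /upd; case: eqP.
rewrite /laplace_marg unlock; apply: eq_integral => w _ /=.
congr ((expR (- _))%:E); rewrite (sum_upd _ (X ^~ w)) big1 ?addr0// => i _.
by rewrite mul0r.
Qed.

Lemma powR_prodr (R : realType) (I : Type) (s : seq I) (F : I -> R) (r : R) :
  (forall i, 0 <= F i) ->
  (\prod_(i <- s) F i) `^ r = \prod_(i <- s) F i `^ r.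
Proof.
move=> F0; elim: s => [|i s IH]; first by rewrite !big_nil powR1.
by rewrite !big_cons powRM ?IH// prodr_ge0.
Qed.

Lemma mnm_of_set1 (n : nat) (i : 'I_n) :
  mnm_of_set [set i]%SET = mpoly.mnm1 i.
Proof. by apply/mpoly.mnmP => j; rewrite !mpoly.mnmE inE eq_sym. Qed.

(* Monotonicity of [th |-> exp (- th . X)] makes the transform finite above the
   given ball, where the identity is continued; it then goes down to the positive
   orthant, and by dominated convergence to its boundary. *)
Lemma multifactor_gamma_ge0 (R : realType) (d : measure_display)
    (T : measurableType d) (Pr : probability T R) (n : nat)
    (P : mpoly.mpoly n R) (lam : R) (lams : 'I_n -> R)
    (X : 'I_n -> {RV Pr >-> R}) :
  affine_mpoly P -> 0 < lam -> (forall i, lam < lams i) ->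
  {ae Pr, forall w, forall i, 0 < X i w} ->
  multifactor_gamma P lam lams X ->
  forall th, (forall i, 0 <= th i) ->
    gamma_at (fun A => mpoly.mcoeff (mnm_of_set A) P) lam lams (Laplace X) th.
Proof.
move=> aP lam0 lamj X0 [z /nbhs_ballP[e /= e0 sub]].
set c := fun A => _.
have inball (th : 'I_n -> R) :
    (forall i, z ord0 i - e < th i < z ord0 i + e) ->
    Laplace_finite X th /\ gamma_at c lam lams (Laplace X) th.
  move=> thz; have /sub[] : ball z e (\row_i th i).
    split => // k i; rewrite mxE (ord1 k) /ball/= ltr_distlC.
    exact: thz.
  have -> : (\row_i th i) ord0 = th by apply/funext => i; rewrite mxE.
  rewrite affine_mevalE// -/c => pP pQ.
  rewrite laplace_rowE => LE.
  (* The positive integrand is integrable because the assumed identity gives its integral a real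
     value. *)
  have fX : Laplace_finite X th.
    apply/integrableP; split.
      by apply/measurable_EFinP; exact: measurable_Laplace_integrand.
    under eq_integral do rewrite /= ger0_norm ?expR_ge0//.
    by rewrite LE ltry.
  have cE i : c [set i]%SET = lin_coef P i by rewrite /c mnm_of_set1.
  have q0 : 0 < \prod_i (1 + c [set i]%SET * th i) `^ (lams i - lam).
    by apply: prodr_gt0 => i _; rewrite powR_gt0// cE.
  split; first exact: fX.
  split; [exact: pP|by move=> i; rewrite cE|].
  have -> : Laplace X th = (multilinear c th `^ lam)^-1 *
      (\prod_i (1 + c [set i]%SET * th i) `^ (lams i - lam))^-1.
    rewrite /Laplace /Rintegral LE /= powRN; congr (_ * _).
    by rewrite -prodfV; apply: eq_bigr => i _; rewrite powRN cE.
  rewrite -mulrA mulrACA mulVf ?mul1r ?mulVf//; first exact: lt0r_neq0.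
  by rewrite lt0r_neq0// powR_gt0.
pose b i := z ord0 i - e.
have up th : (forall i, b i < th i) -> gamma_at c lam lams (Laplace X) th.
  apply: (@coordinatewise_extension _ _ (fun i t => b i < t < z ord0 i + e)
    (fun i t => b i < t)).
  - by move=> i t /andP[].
  - move=> {}th j bth gth; rewrite -(upd_id th j).
    apply: (@gamma_at_continuation _ _ _ _ _ _ _ _ _ _ _ (b j) (b j)
      (z ord0 j + e)) => //.
    + by rewrite /b; lra.
    + move=> t bt.
      (* Capping the coordinates at [z + e / 2] gives a point of the ball below the given one, where
         the transform is finite. *)
      pose th0 i := Num.min (upd th j t i) (z ord0 i + e / 2).
      apply: (@Laplace_finite_le _ _ _ _ _ _ th0) => //.
        by move=> i; rewrite /th0 ge_min lexx.
      have [] // := inball th0.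
      move=> i; rewrite /th0 lt_min gt_min.
      have : b i < upd th j t i by rewrite /upd; case: eqP => [->|].
      rewrite /b => ->/=; apply/andP; split; [lra|apply/orP; right; lra].
  - by move=> {}th bth; have [] := inball th bth.
have down th : (forall i, 0 < th i) -> gamma_at c lam lams (Laplace X) th.
  (* The starting intervals lie above both [b i] and 0, hence in the region already reached; the
     continuation then goes down to 0, finiteness being automatic on the orthant. *)
  apply: (@coordinatewise_extension _ _
    (fun i t => Num.max (b i) 0 < t < Num.max (b i) 0 + 1) (fun i t => 0 < t)).
  - by move=> i t /andP[]; rewrite gt_max => /andP[].
  - move=> {}th j bth gth; rewrite -(upd_id th j).
    apply: (@gamma_at_continuation _ _ _ _ _ _ _ _ _ _ _ 0
      (Num.max (b j) 0) (Num.max (b j) 0 + 1)) => //.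
    + by rewrite le_max lexx orbT.
    + by rewrite ltrDl.
    + move=> t t0; apply: (Laplace_finite_ge0 X0) => i.
      by rewrite /upd; case: eqP => _; exact: ltW.
  - by move=> {}th bth; apply: up => i; have /andP[] := bth i; rewrite gt_max => /andP[].
apply: (@coordinatewise_extension _ _ (fun i t => 0 < t) (fun i t => 0 <= t)) => //.
  by move=> i t; exact: ltW.
move=> th j th0 gth; have := th0 j; rewrite le_eqVlt => /predU1P[tj|]; last first.
  by move=> /gth; rewrite upd_id.
by rewrite -(upd_id th j) -tj; exact: gamma_at_closure.
Qed.

(** * Marginal transforms and the copula formula *)

(** On the axis the polynomial reduces to [1 + p_j t], so the exponents [lam] and [lams j - lam] add
    up. *)
Lemma gamma_at_axis (R : realType) (n : nat) (c : {set 'I_n} -> R) (lam : R)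
    (lams : 'I_n -> R) (L : ('I_n -> R) -> R) (j : 'I_n) (t : R) :
  c finset.set0 = 1 ->
  gamma_at c lam lams L (upd (fun=> 0) j t) ->
  L (upd (fun=> 0) j t) = (1 + c [set j]%SET * t) `^ (- lams j).
Proof.
move=> c0 [_ /(_ j)]; rewrite multilinear_axis c0 /upd eqxx => p0.
rewrite (bigD1 j)//= eqxx big1 ?mulr1 => [|i ij]; last first.
  by rewrite (negbTE ij) mulr0 addr0 powR1.
rewrite -mulrA -powRD; last by rewrite (gt_eqF p0) implybT.
rewrite [lam + _]addrC subrK => E; apply: (mulIf (lt0r_neq0 (powR_gt0 (lams j) p0))).
by rewrite E powRN mulVf// gt_eqF// powR_gt0.
Qed.

Lemma gamma_lin_gt0 (R : realType) (d : measure_display)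
    (T : measurableType d) (Pr : probability T R) (n : nat)
    (X : 'I_n -> {RV Pr >-> R}) (c : {set 'I_n} -> R) (lam : R)
    (lams : 'I_n -> R) (j : 'I_n) :
  c finset.set0 = 1 -> {ae Pr, forall w, forall i, 0 < X i w} ->
  (forall th, (forall i, 0 <= th i) -> gamma_at c lam lams (Laplace X) th) ->
  0 < c [set j]%SET.
Proof.
move=> c0 X0 gX.
have gj t : 0 <= t -> gamma_at c lam lams (Laplace X) (upd (fun=> 0) j t).
  by move=> t0; apply: gX => i; rewrite /upd; case: eqP.
rewrite ltNge le_eqVlt; apply/negP => /predU1P[p0|pn]; last first.
  (* A negative [p_j] would make the factor [1 + p_j t], positive for [t >= 0], vanish at
     [t = - 1 / p_j]. *)
  have t0 : 0 <= - (c [set j]%SET)^-1 by rewrite oppr_ge0 invr_le0 ltW.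
  have [_ /(_ j) + _] := gj _ t0.
  by rewrite /upd eqxx mulrN mulfV ?lt_eqF// subrr ltxx.
(* If [p_j = 0], the transform of [X_j] is constant, so that [X_j = 0]. *)
have L1 : Laplace X (upd (fun=> 0) j 1) = 1.
  by rewrite (gamma_at_axis c0 (gj _ ler01)) p0 mul0r addr0 powR1.
have fX : Laplace_finite X (upd (fun=> 0) j 1).
  by apply: (Laplace_finite_ge0 X0) => i; rewrite /upd; case: eqP.
have i1 : Pr.-integrable setT (EFin \o (cst (1 : R))).
  exact: finite_measure_integrable_cst.
pose e w := expR (- \sum_(i < n) upd (fun=> 0) j 1 i * X i w).
have eE w : e w = expR (- X j w).
  rewrite /e (sum_upd _ (X ^~ w)) mul1r big1 ?addr0// => i _.
  by rewrite mul0r.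
(* The absolute value gives a function that is non-negative everywhere, while [1 - e w] is so only
   almost surely. *)
have i3 : Pr.-integrable setT (EFin \o (fun w => `|1 - e w|)).
  rewrite (_ : _ \o _ = abse \o (EFin \o (cst 1 \- e))).
    by apply: integrable_abse; exact: (integrableB measurableT i1 fX).
  by apply/funext.
have : 0 < \int[Pr]_w `|1 - e w|.
  apply: Rintegral_gt0 => //.
  apply: filterS X0 => w Xw; rewrite normr_gt0 subr_eq0 gt_eqF//.
  by rewrite eE -expR0 ltr_expR oppr_lt0.
rewrite (_ : \int[Pr]_w `|1 - e w| = \int[Pr]_w (cst 1 w - e w)).
  rewrite RintegralB// Rintegral_cst// mul1r [X in _ - X]L1.
  by rewrite [X in fine X](probability_setT Pr) subrr ltxx.
rewrite /Rintegral; congr (fine _).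
apply: ae_eq_integral => //.
- exact: measurable_int i3.
- exact: measurable_int (integrableB measurableT i1 fX).
- apply: filterS X0 => w Xw _; rewrite ger0_norm// subr_ge0 eE.
  by rewrite -expR0 ler_expR oppr_le0 ltW.
Qed.

Lemma powRVr (R : realType) (x r : R) : 0 <= x -> x^-1 `^ r = (x `^ r)^-1.
Proof. by move=> x0; rewrite -powR_inv1// -powRrM mulN1r powRN. Qed.

Theorem theorem16 (R : realType) (n : nat) (P : mpoly.mpoly n R)
    (lam : R) (lams : 'I_n -> R)
    (d : measure_display) (T : measurableType d) (Pr : probability T R)
    (X : 'I_n -> {RV Pr >-> R})
    (P_affine : affine_mpoly P)
    (P0 : mpoly.meval (fun=> 0) P = 1)
    (lam_gt0 : 0 < lam)
    (lams_gt : forall i : 'I_n, lam < lams i)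
    (X_gt0 : Pr [set w | forall i : 'I_n, 0 < X i w] = 1%E)
    (X_gamma : multifactor_gamma P lam lams X) :
  (forall i : 'I_n, 0 < lin_coef P i) /\
  forall v : 'rV[R]_n, (forall i : 'I_n, 0 < v ord0 i <= 1) ->
    laplace_copula X v =
      (\prod_(i < n) v ord0 i) *
      (1 + \sum_(A : {set 'I_n} | (1 < #|A|)%N)
             (-1) ^+ #|A| *
             mpoly.meval (fun i => - inv_coef_ind P A i) P *
             \prod_(t in A) (1 - v ord0 t `^ (1 / lams t))) `^ (- lam).
Proof.
have X0 := ae_forall_gt0 X_gt0.
have gX := multifactor_gamma_ge0 P_affine lam_gt0 lams_gt X0 X_gamma.
set c := fun A => _ in gX.
have cE i : c [set i]%SET = lin_coef P i by rewrite /c mnm_of_set1.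
have c0 : c finset.set0 = 1 by rewrite -P0 affine_mevalE// multilinear0.
have p0 i : 0 < lin_coef P i by rewrite -cE; exact: gamma_lin_gt0 c0 X0 gX.
split=> // v v01.
have l0 i : 0 < lams i by exact: lt_trans (lams_gt i).
have vgt0 i : 0 < v ord0 i by case/andP: (v01 i).
pose x i := v ord0 i `^ (1 / lams i).
have x0 i : 0 < x i by exact: powR_gt0.
have xv i : x i `^ lams i = v ord0 i.
  by rewrite /x -powRrM div1r mulVf ?gt_eqF// powRr1// ltW.
have x1 i : x i <= 1.
  have /andP[v0 v1] := v01 i; rewrite -[leRHS](_ : 1 `^ (1 / lams i) = 1); last by rewrite powR1.
  by apply: ge0_ler_powR; rewrite ?nnegrE// ?divr_ge0// ltW.
pose th i := ((x i)^-1 - 1) / c [set i]%SET.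
have th0 i : 0 <= th i.
  by rewrite /th cE divr_ge0 ?(ltW (p0 i))// subr_ge0 invf_ge1.
have thE i : 1 + c [set i]%SET * th i = (x i)^-1.
  by rewrite /th mulrC divfK ?cE ?gt_eqF// addrC subrK.
have margE j t : 0 <= t ->
    laplace_marg (X j) t = ((1 + lin_coef P j * t) `^ (- lams j))%:E.
  move=> t0; rewrite (laplace_margE _ X0)// -cE; congr EFin.
  apply: (@gamma_at_axis _ _ c lam) => //; apply: gX => i.
  by rewrite /upd; case: eqP.
(* The marginal transform takes the value [v_i] at [th i], and it is injective on [[0, +oo[] because
   [p_i] and [lams i] are positive. *)
have pinvE i : 'pinv_(fun=> 0) [set t : R | 0 <= t] (laplace_marg (X i))
    (v ord0 i)%:E = th i.
  have -> : (v ord0 i)%:E = laplace_marg (X i) (th i).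
    by rewrite margE// -cE thE powRN powRVr ?ltW// invrK xv.
  apply: pinvKV; last by rewrite inE; exact: th0.
  move=> s t; rewrite !inE/= => s0 t0; rewrite !margE// => -[].
  rewrite !powRN => /invr_inj st.
  have ge1 u : 0 <= u -> 1 + lin_coef P i * u \is Num.nneg.
    by move=> u0; rewrite nnegrE addr_ge0// mulr_ge0// ltW.
  have /addrI := powR_injective (l0 i) (ge1 _ s0) (ge1 _ t0) st.
  by apply: mulfI; rewrite gt_eqF.
rewrite /laplace_copula (_ : (\row_i _) = \row_i th i); last first.
  by apply/rowP => i; rewrite !mxE pinvE.
rewrite laplace_rowE -[LHS]/(Laplace X th).
have [pP pQ E] := gX _ th0.
have c_neq0 i : c [set i]%SET != 0 by rewrite cE lt0r_neq0.
have H := multilinear_reciprocal c0 c_neq0 (fun i => lt0r_neq0 (x0 i)).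
rewrite -[multilinear _ _]/(multilinear c th) in H.
rewrite [X in X `^ _](_ : _ = (\prod_i x i) * multilinear c th); last first.
  rewrite H; congr (1 + _); apply: eq_bigr => A _; congr (_ * _ * _).
  rewrite affine_mevalE//; congr multilinear; apply/funext => i.
  by rewrite /inv_coef_ind cE.
(* At [th] the identity reads [L * P ^ lam = q], while the product of the [v_i] is [q] times the
   product of the [x i] to the power [lam]; eliminating [q] gives the formula. *)
pose q := \prod_i x i `^ (lams i - lam).
have q0 : 0 < q by apply: prodr_gt0 => i _; exact: powR_gt0.
have px0 : 0 < \prod_i x i by apply: prodr_gt0 => i _; exact: x0.
have s0 := powR_gt0 lam px0.
have r0 := powR_gt0 lam pP.
have -> : \prod_(i < n) v ord0 i = q * (\prod_i x i) `^ lam.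
  rewrite powR_prodr => [|i]; last exact: ltW.
  rewrite /q -big_split/=; apply: eq_bigr => i _.
  by rewrite -powRD ?subrK ?xv// (gt_eqF (x0 i)) implybT.
rewrite powRN powRM ?(ltW px0) ?(ltW pP)//.
have {}E : Laplace X th * multilinear c th `^ lam = q.
  rewrite -[RHS]mul1r -E -[RHS]mulrA -[LHS]mulr1; congr (_ * _).
  rewrite /q -big_split/= big1// => i _.
  by rewrite thE powRVr ?ltW// mulVf// gt_eqF// powR_gt0.
by rewrite -E; field; rewrite !gt_eqF.
Qed.
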